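(* Let $\mathbb F_q$ be a finite field with $q$ elements, let $n\ge 2$, let $a_1,\dots,a_n,b\in\mathbb F_q^*$ and let $k,k_1,\dots,k_n,m_1,\dots,m_n$ be positive integers. Let $N_q$ be the number of solutions $(x_1,\dots,x_n)\in\mathbb F_q^n$ of $$(a_1x_1^{m_1}+\dots+a_nx_n^{m_n})^k=bx_1^{k_1}\cdots x_n^{k_n}.$$ Let $d_j=\gcd(m_j,q-1)$ and $k_0=\gcd(k,k_1,\dots,k_n,q-1)$. Assume that for some $0\le t\le n$, $d_1,\dots,d_t$ are odd, $d_{t+1},\dots,d_n$ are even, and the numbers $d_1,\dots,d_t,d_{t+1}/2,\dots,d_n/2$ are pairwise coprime; and assume that $b$ is not a $k_0$th power in $\mathbb F_q$. Then: if $t=0$ and $n$ is even, $$N_q=q^{n-1}-\frac{(q-1)^n+q-1}{q}-(q-1)\sum_{j=1}^{(n-2)/2}\eta((-1)^j)\sigma_{2j}(\eta(a_1),\dots,\eta(a_n))q^{j-1};$$ if $t=n$, $$N_q=q^{n-1}-\frac{(q-1)^n+(-1)^n(q-1)}{q};$$ otherwise $$N_q=q^{n-1}-\frac{(q-1)^n+(-1)^n(q-1)}{q}-(-1)^n(q-1)\sum_{j=1}^{[(n-t)/2]}\eta((-1)^j)\sigma_{2j}(\eta(a_{t+1}),\dots,\eta(a_n))q^{j-1}.$$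
   Context: For $q$ odd, $\eta$ is the quadratic character of $\mathbb F_q$: $\eta(x)=1,-1,0$ according as $x$ is a nonzero square, a nonsquare, or $0$ (in the cases where $\eta$ appears, some $d_j$ is even, so $q$ is odd). $\sigma_{2j}(z_1,\dots,z_r)$ denotes the elementary symmetric polynomial of degree $2j$ in $z_1,\dots,z_r$. $[x]$ denotes the integer part; empty sums are $0$. *)

(* Defs.v *)
From mathcomp Require Import all_boot all_order all_algebra.
Set Implicit Arguments. Unset Strict Implicit. Unset Printing Implicit Defensive.
Import Order.TTheory GRing.Theory Num.Theory.
Local Open Scope ring_scope.

Definition qchar (F : finFieldType) (x : F) : int :=
  if x == 0 then 0
  else if [exists y : F, y ^+ 2 == x] then 1 else -1.

Definition esym_seq (s : seq int) (r : nat) : int :=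
  \sum_(I : {set 'I_(size s)} | #|I| == r) \prod_(i in I) s`_i.

Definition Nsol (F : finFieldType) (n : nat) (a : 'I_n -> F) (b : F)
    (k : nat) (kk m : 'I_n -> nat) : nat :=
  #|[set x : {ffun 'I_n -> F} |
      (\sum_(i < n) a i * x i ^+ m i) ^+ k == b * \prod_(i < n) x i ^+ kk i]|.

(* Main.v *)
(* Since b is not a k0-th power, every solution has a zero coordinate, so N_q
   counts the zeros of the diagonal form sum a_i x_i^(m_i) having some x_i = 0.
   Monomial substitutions of the form x_i -> x_i^u, x_j -> x_j * x_i^r preserve
   this set of points, and the coprimality assumptions let them lower each
   exponent to 1 or 2 according to the parity of d_i.
   For such forms, the number of solutions of sum = y is computed by adding one
   variable at a time: as functions of y, the counts stay in the span of 1, the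
   indicator of 0 and eta.  Modulo constants, convolution by eta squares to
   eta(-1) q, and adding a variable x with term a x^2 multiplies by eta(a) eta,
   or by eta(a) eta - 1 if x must be nonzero.  The counts are therefore read off
   the polynomials prod (eta(a_i) X) and prod (eta(a_i) X - 1). *)
Require Import Defs.
From mathcomp Require Import all_boot all_order all_algebra all_field.
From mathcomp Require Import zify ring.
Import Order.TTheory GRing.Theory Num.Theory.
Local Open Scope ring_scope.

(** * Bezout multipliers and power maps on a finite field *)

(* Bezout only makes the multiplier coprime to L / gcd m L; adding multiples of
   L / gcd m L avoids the remaining primes of N. *)
Lemma bezout_coprime (m L N : nat) : (0 < m -> 0 < L -> 0 < N ->
  exists u v, [/\ coprime u N, 0 < u & u * m = v * L + gcdn m L])%N.
Proof.
move=> m0 L0 N0.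
case: (egcdnP L m0) => u0 v0 eqg _.
have g0 : (0 < gcdn m L)%N by rewrite gcdn_gt0 m0.
case/dvdnP: (dvdn_gcdl m L) => m' Em; case/dvdnP: (dvdn_gcdr m L) => L' EL.
set g := gcdn m L in g0 Em EL eqg *.
have m'0 : (0 < m')%N by nia.
have L'0 : (0 < L')%N by nia.
have u00 : (0 < u0)%N by nia.
have cuL : coprime u0 L'.
  apply/coprimeP => //; exists (m', v0) => /=; nia.
(* [s] is the largest divisor of [N] prime to [u0], so each prime of [N] divides exactly one of [u0]
   and [s * L'], hence not their sum. *)
set s := (N`_(\pi(u0)^'))%N.
have s0 : (0 < s)%N by rewrite part_gt0.
exists (u0 + s * L')%N, (v0 + s * m')%N; split; [|lia|rewrite {1}Em {1}EL; nia].
rewrite coprime_has_primes ?addn_gt0 ?u00 //; apply/hasPn => p.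
rewrite !mem_primes N0 /= => /andP[pp pN]; apply/negP => /and3P[_ _ pd].
have [pu|pu] := boolP (p %| u0)%N.
  move: pd; rewrite dvdn_addr // Euclid_dvdM // => /orP[ps|pL].
    have := part_pnat (\pi(u0)^') N; move/pnatP => /(_ (part_gt0 _ _) p pp ps).
    by rewrite !inE /= mem_primes pp u00 pu.
  have : (p %| gcdn u0 L')%N by rewrite dvdn_gcd pu pL.
  by rewrite (eqnP cuL) dvdn1 => /eqP p1; rewrite p1 in pp.
have ps : (p %| s)%N.
  have pi_p : (\pi(u0)^').-nat p by rewrite pnatE // !inE /= mem_primes pp u00.
  by rewrite -(part_pnat_id pi_p) partn_dvd.
by move: pd; rewrite dvdn_addl ?(negPf pu) // dvdn_mulr.
Qed.

Lemma finField_gt1 (F : finFieldType) : (1 < #|F|)%N.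
Proof. by rewrite -cardsT; apply/card_gt1P; exists 0, 1; rewrite !inE eq_sym oner_neq0. Qed.

Lemma finField_expf_pred (F : finFieldType) (x : F) : x != 0 -> x ^+ #|F|.-1 = 1.
Proof.
move=> x0; apply: (mulfI x0); rewrite -exprS prednK ?expf_card ?mulr1 //.
exact: ltnW (finField_gt1 F).
Qed.

Lemma expf_inj (F : finFieldType) (u : nat) :
  coprime u #|F|.-1 -> (0 < u)%N -> injective (fun x : F => x ^+ u).
Proof.
move=> cu u0; case: (egcdnP #|F|.-1 u0) => u' v'; rewrite (eqnP cu) => E _.
apply: (@can_inj _ _ _ (fun y => y ^+ u')) => x.
rewrite -exprM mulnC E addn1; have [->|x0] := eqVneq x 0; first by rewrite expr0n.
by rewrite exprS mulnC exprM finField_expf_pred // expr1n mulr1.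
Qed.

(** * Points with a zero coordinate and reduction of exponents *)

Definition zeros_with_zero {F : finFieldType} {n} (a : 'I_n -> F) (c : 'I_n -> nat) :=
  [set x : {ffun 'I_n -> F} |
    (\sum_(i < n) a i * x i ^+ c i == 0) && [exists i, x i == 0]].

(* Substituting x_i0 -> x_i0^u and x_j -> x_j * x_i0^(v * r_j) multiplies the
   diagonal form with exponent gcd(c_i0, L) at i0 by x_i0^(v * L), where
   u * c_i0 = v * L + gcd(c_i0, L). *)
Lemma card_zeros_gcd {F : finFieldType} {n} (a : 'I_n -> F) (c c' r : 'I_n -> nat)
    (i0 : 'I_n) (L : nat) :
  (0 < L)%N -> (0 < c i0)%N ->
  (forall j (l : F), j != i0 -> l != 0 -> l ^+ (r j * c j) = l ^+ L) ->
  (forall j, j != i0 -> c' j = c j) -> c' i0 = gcdn (c i0) L ->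
  #|zeros_with_zero a c| = #|zeros_with_zero a c'|.
Proof.
move=> L0 c0 rP cc' c'0.
have N0 : (0 < #|F|.-1)%N by have := finField_gt1 F; case: #|F| => [|[]].
have [u [v [cu u0 uv]]] := bezout_coprime _ _ _ c0 L0 N0.
(* The value 1 when [x i0] is 0 keeps the substitution invertible on the points with [x i0 = 0]. *)
pose lam (x : {ffun 'I_n -> F}) := if x i0 == 0 then 1 else x i0.
have lam0 x : lam x != 0 by rewrite /lam; case: ifP => [_|/negbT//]; exact: oner_neq0.
pose f (x : {ffun 'I_n -> F}) : {ffun 'I_n -> F} :=
  [ffun j => if j == i0 then x i0 ^+ u else x j * lam x ^+ (v * r j)].
have f_inj : injective f.
  move=> x y fxy.
  have E0 : x i0 = y i0.
    by apply: (expf_inj F u cu u0); have := congr1 (fun h : {ffun _} => h i0) fxy; rewrite !ffunE eqxx.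
  have El : lam x = lam y by rewrite /lam E0.
  apply/ffunP => j; have [->//|nj] := eqVneq j i0.
  have := congr1 (fun h : {ffun _} => h j) fxy; rewrite !ffunE (negPf nj) El.
  by apply: mulIf; rewrite expf_neq0.
rewrite -(card_preimset _ f_inj); apply: eq_card => x; rewrite !inE.
congr (_ && _); last first.
  apply: eq_existsb => j; rewrite ffunE; have [->|_] := eqVneq j i0.
    by rewrite expf_eq0 u0.
  by rewrite mulf_eq0 [_ ^+ _ == 0]expf_eq0 (negPf (lam0 x)) andbF orbF.
have -> : \sum_(i < n) a i * f x i ^+ c i =
          lam x ^+ (v * L) * \sum_(i < n) a i * x i ^+ c' i.
  rewrite mulr_sumr; apply: eq_bigr => j _; rewrite ffunE mulrCA; congr (_ * _).
  have [->|nj] := eqVneq j i0.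
    rewrite -exprM uv c'0 /lam; case: eqP => [->|_]; last by rewrite exprD.
    have g0 : (gcdn (c i0) L == 0)%N = false by rewrite gtn_eqF // gcdn_gt0 c0.
    by rewrite !expr0n addn_eq0 g0 andbF mulr0.
  by rewrite exprMn cc' // -exprM -mulnA !(mulnC v) mulrC [X in X * _]exprM rP // -exprM.
by rewrite mulf_eq0 expf_eq0 (negPf (lam0 x)) andbF.
Qed.

(* Exchanging the values of c for those of c' one index at a time. *)
Lemma eq_by_replacement {T : Type} {n} (f : ('I_n -> nat) -> T) (c c' : 'I_n -> nat) :
  (forall h h', h =1 h' -> f h = f h') ->
  (forall i h h', (forall j, h j = c j \/ h j = c' j) ->
     (forall j, j != i -> h' j = h j) -> h i = c i -> h' i = c' i -> f h = f h') ->
  f c = f c'.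
Proof.
move=> f_ext step.
pose h s (i : 'I_n) := if (i < s)%N then c' i else c i.
have E s : (s <= n)%N -> f c = f (h s).
  elim: s => [_|s IH sn]; first by apply: f_ext => i; rewrite /h ltn0.
  rewrite IH ?(ltnW sn) //; apply: (step (Ordinal sn)); rewrite /h /= ?ltnn ?ltnSn //.
    by move=> j; case: ifP; auto.
  by move=> j; rewrite -val_eqE /= ltnS [(j <= s)%N]leq_eqVlt => /negPf->.
by rewrite (E n) //; apply: f_ext => i; rewrite /h ltn_ord.
Qed.

Lemma eq_zeros_with_zero {F : finFieldType} {n} (a : 'I_n -> F) (c c' : 'I_n -> nat) :
  c =1 c' -> #|zeros_with_zero a c| = #|zeros_with_zero a c'|.
Proof.
move=> cc'; apply: eq_card => x; rewrite !inE; congr (_ && _).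
by under eq_bigr do rewrite cc'.
Qed.

(** With L and all r_j equal to q - 1, both powers of a nonzero element compared in [card_zeros_gcd]
    are 1. *)
Lemma card_zeros_gcd_pred {F : finFieldType} {n} (a : 'I_n -> F) (m : 'I_n -> nat) :
  (forall i, 0 < m i)%N ->
  #|zeros_with_zero a m| = #|zeros_with_zero a (fun i => gcdn (m i) #|F|.-1)|.
Proof.
move=> m0; apply: (eq_by_replacement (fun c => #|zeros_with_zero a c|)).
  by move=> h h'; apply: eq_zeros_with_zero.
move=> i h h' hP hh' hi h'i.
apply: (card_zeros_gcd a h h' (fun=> #|F|.-1) i #|F|.-1) => //; last by rewrite hi.
- by have := finField_gt1 F; case: #|F| => [|[]].
- by rewrite hi.
- by move=> j l _ l0; rewrite exprM !finField_expf_pred // expr1n.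
Qed.

(** At index i, take L = 2M with M the product of the other v_j. Every other current exponent, s_j
    v_j or s_j, divides L, so r_j is the quotient. Coprimality, and oddness of v_i when s_i = 1,
    give gcd(s_i v_i, 2M) = s_i. *)
Lemma card_zeros_parity {F : finFieldType} {n} (a : 'I_n -> F) (s v : 'I_n -> nat) :
  (forall i, 0 < v i)%N -> (forall i, s i = 2 \/ s i = 1 /\ odd (v i))%N ->
  (forall i j, i != j -> coprime (v i) (v j)) ->
  #|zeros_with_zero a (fun i => s i * v i)%N| = #|zeros_with_zero a s|.
Proof.
move=> v0 sP cop; apply: (eq_by_replacement (fun c => #|zeros_with_zero a c|)).
  by move=> h h'; apply: eq_zeros_with_zero.
move=> i h h' hP hh' hi h'i.
have sdvd j : (s j %| 2)%N by case: (sP j) => [->|[->]].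
have s0 j : (0 < s j)%N by case: (sP j) => [->|[->]].
pose M := (\prod_(j | j != i) v j)%N.
have M0 : (0 < M)%N by apply: prodn_cond_gt0 => j _.
have copM : coprime (v i) M.
  by rewrite /M; elim/big_rec: _ => [|j y ji IH]; rewrite ?coprimen1 // coprimeMr IH cop // eq_sym.
have hdvd j : j != i -> (h j %| 2 * M)%N.
  move=> ji; apply: (@dvdn_trans (s j * v j)).
    by case: (hP j) => ->; [exact: dvdnn|exact: dvdn_mulr].
  by rewrite dvdn_mul // /M (bigD1 j) //= dvdn_mulr.
apply: (card_zeros_gcd a h h' (fun j => 2 * M %/ h j)%N i (2 * M)) => //.
- by rewrite muln_gt0.
- by rewrite hi muln_gt0 s0 v0.
- by move=> j l ji _; rewrite divnK // hdvd.
- rewrite h'i hi; case: (sP i) => [->|[-> ov]].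
    by rewrite -muln_gcdr (eqnP copM) muln1.
  by rewrite mul1n; apply/esym/eqP; rewrite -/(coprime _ _) coprimeMr copM coprimen2 ov.
Qed.

(** A zero coordinate kills the right-hand side and forces the form to vanish. At a solution without
    one, dividing all exponents by their common divisor [e] exhibits an [e]-th root of [b]. *)
Lemma Nsol_zeros (F : finFieldType) (n : nat) (a : 'I_n -> F) (b : F)
    (k : nat) (kk m : 'I_n -> nat) :
  (0 < k)%N -> (forall i, 0 < kk i)%N -> b != 0 ->
  ~ (exists y : F, y ^+ gcdn k (gcdn (\big[gcdn/0%N]_(i < n) kk i) #|F|.-1) = b) ->
  Nsol a b k kk m = #|zeros_with_zero a m|.
Proof.
move=> k0 kk0 b0 nb; apply: eq_card => x; rewrite !inE.
set S := \sum_(i < n) _.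
have [/existsP[i /eqP xi0]|] := boolP [exists i, x i == 0].
  rewrite andbT (bigD1 i) //= xi0 expr0n gtn_eqF // mul0r mulr0.
  by rewrite expf_eq0 k0.
rewrite negb_exists => /forallP x0; rewrite andbF; apply/eqP => E; apply: nb.
set e := gcdn _ _.
have ek : (e %| k)%N by rewrite dvdn_gcdl.
have ekk i : (e %| kk i)%N.
  apply: (dvdn_trans (dvdn_gcdr _ _)); apply: (dvdn_trans (dvdn_gcdl _ _)).
  by rewrite (bigD1 i) //= dvdn_gcdl.
exists (S ^+ (k %/ e) / \prod_i x i ^+ (kk i %/ e)).
rewrite exprMn exprVn -exprM divnK // E -prodrXl.
have -> : \prod_i (x i ^+ (kk i %/ e)) ^+ e = \prod_i x i ^+ kk i.
  by apply: eq_bigr => i _; rewrite -exprM divnK.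
by rewrite mulfK //; apply/prodf_neq0 => i _; rewrite expf_neq0.
Qed.

(** * The quadratic character and its convolutions *)

Section QuadraticCharacter.
Context (F : finFieldType) (char_odd : (2 : F) != 0).
Implicit Types x y a u : F.

Lemma qchar0 : qchar (0 : F) = 0.
Proof. by rewrite /qchar eqxx. Qed.

Lemma qchar_sqr y : y != 0 -> qchar (y ^+ 2) = 1.
Proof.
move=> y0; rewrite /qchar expf_eq0 (negPf y0) /=; case: existsP => // - [].
by exists y.
Qed.

Lemma qchar1 : qchar (1 : F) = 1.
Proof. by rewrite -(expr1n F 2) qchar_sqr ?oner_neq0. Qed.

Lemma card_sqrt u : #|[set x : F | x ^+ 2 == u]|%:R = 1 + qchar u :> int.
Proof.
rewrite /qchar; have [->|u0] := eqVneq.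
  by rewrite (_ : [set x | _] = [set 0]) ?cards1 //; apply/setP => x; rewrite !inE expf_eq0.
case: existsP => [[y /eqP yu]|ne]; last first.
  by rewrite (_ : [set x | _] = set0) ?cards0 //; apply/setP => x; rewrite !inE; apply/negP => xu; apply: ne; exists x.
have y0 : y != 0 by apply: contraNneq u0 => y0; rewrite -yu y0 expr0n.
have ny : y != - y by rewrite -addr_eq0 -mulr2n -mulr_natl mulf_neq0.
rewrite -yu (_ : [set x | _] = [set y; - y]) ?cards2 ?ny //.
by apply/setP => x; rewrite !inE eqf_sqr.
Qed.

(** The fibre of squaring over u has 1 + eta(u) points. *)
Lemma sum_sqr {R : nzRingType} (f : F -> R) :
  \sum_x f (x ^+ 2) = \sum_u f u * (1 + qchar u)%:~R.
Proof.
rewrite (partition_big (fun x => x ^+ 2) predT) //=; apply: eq_bigr => u _.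
under eq_bigr => x /eqP -> do [].
by rewrite sumr_const -card_sqrt rmorph_nat mulr_natr cardsE.
Qed.

Lemma sum_qchar : \sum_(u : F) qchar u = 0.
Proof.
(* For the constant 1, this reads q = q + sum of eta. *)
have := sum_sqr (fun _ : F => 1 : int).
under [X in _ = X -> _]eq_bigr do rewrite mul1r intz.
by rewrite big_split /= => /(canLR (addKr _)) <-; rewrite addNr.
Qed.

Lemma sum_qcharM a : a != 0 -> \sum_(u : F) qchar (a * u) = 0.
Proof.
move=> a0; rewrite -[RHS]sum_qchar [RHS](reindex_inj (mulfI a0)) //.
Qed.

Lemma qchar_sqrM y u : y != 0 -> qchar (y ^+ 2 * u) = qchar u.
Proof.
move=> y0; rewrite /qchar mulf_eq0 expf_eq0 (negPf y0) /=; case: eqP => // _.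
congr (if _ then _ else _); apply/existsP/existsP => - [z /eqP zE].
  by exists (z / y); rewrite exprMn exprVn zE mulrC mulKf ?expf_neq0.
by exists (y * z); rewrite exprMn zE.
Qed.

(* For a nonsquare a, the sum over u of qchar (a * u) + qchar u is 0 and its
   terms are nonpositive, so they all vanish. *)
Lemma qcharM a u : qchar (a * u) = qchar a * qchar u.
Proof.
have [->|a0] := eqVneq a 0; first by rewrite mul0r qchar0 mul0r.
have [/existsP[y /eqP ya]|nsq] := boolP [exists y, y ^+ 2 == a].
  have y0 : y != 0 by apply: contraNneq a0 => y0; rewrite -ya y0 expr0n.
  by rewrite -ya qchar_sqrM // qchar_sqr // mul1r.
have qa : qchar a = -1 by rewrite /qchar (negPf a0) (negPf nsq).
have q_le1 (z : F) : qchar z <= 1 by rewrite /qchar; do !case: ifP.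
have nonpos (z : F) : qchar (a * z) + qchar z <= 0.
  have [->|z0] := eqVneq z 0; first by rewrite mulr0 qchar0.
  rewrite [X in _ + X]/qchar (negPf z0); case: existsP => [[y /eqP yz]|_]; last first.
    by rewrite subr_le0.
  have y0 : y != 0 by apply: contraNneq z0 => y0; rewrite -yz y0 expr0n.
  by rewrite -yz mulrC qchar_sqrM // qa.
have : \sum_(z : F) - (qchar (a * z) + qchar z) = 0.
  by rewrite sumrN big_split /= sum_qcharM // sum_qchar addr0 oppr0.
move/psumr_eq0P => /(_ (fun z _ => _)) H.
have := H _ u isT; rewrite qa mulN1r => /(_ _)/eqP; rewrite oppr_eq0 addr_eq0 => E.
by apply/eqP/E => z; rewrite oppr_ge0.
Qed.

Lemma qcharX a k : qchar (a ^+ k) = qchar a ^+ k.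
Proof.
elim: k => [|k IH]; first by rewrite !expr0 qchar1.
by rewrite !exprS qcharM IH.
Qed.

Lemma sqr_qchar a : a != 0 -> qchar a ^+ 2 = 1.
Proof. by move=> a0; rewrite -qcharX qchar_sqr. Qed.

(** The equation y = a x^2 has 1 + eta(a) eta(y) solutions; the q terms 1/q remove the 1. *)
Lemma sum_eq_scaled_sqr a y : a != 0 ->
  \sum_x ((y == a * x ^+ 2)%:R - #|F|%:R^-1) = (qchar a)%:~R * (qchar y)%:~R :> rat.
Proof.
move=> a0; have F0 : (#|F|%:R : rat) != 0 by rewrite pnatr_eq0 -lt0n; apply/card_gt0P; exists 0.
rewrite sumrB sumr_const -[_^-1 *+ _]mulr_natl mulfV //.
rewrite (sum_sqr (fun u => (y == a * u)%:R)) (bigD1 (y / a)) //= big1 => [|u].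
  rewrite [a * _]mulrC divfK // eqxx mulr1n mul1r addr0 rmorphD /= mulr1z addrAC subrr add0r.
  by rewrite qcharM -(qchar_sqrM a a^-1) // expr2 mulfK // mulrC rmorphM.
by move=> ne; case: eqP => [yE|_]; [case/eqP: ne; rewrite yE mulrC mulKf|rewrite mul0r].
Qed.

(** For y = 0 each nonzero u contributes eta(-a). Otherwise dividing by u^2 and setting v = y/u
    gives the sum of eta(v - a) over nonzero v, which is a zero full sum minus eta(-a). *)
Lemma sum_qchar_jacobi a y : a != 0 ->
  \sum_(u : F) qchar (y - a * u) * qchar u
    = qchar (- a) * (#|F|%:R * (y == 0 :> F)%:R - 1).
Proof.
move=> a0; have na0 : - a != 0 by rewrite oppr_eq0.
have cF0 : (0 < #|F|)%N by apply/card_gt0P; exists 0.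
rewrite (bigD1 0) //= qchar0 mulr0 add0r.
have [->|y0] := eqVneq y 0.
  under eq_bigr => u u0 do rewrite sub0r -mulNr qcharM -mulrA -expr2 sqr_qchar // mulr1.
  by rewrite sumr_const mulr1 cardC1 -subn1 -[LHS]mulr_natr natrB.
rewrite mulr0 sub0r mulrN1.
transitivity (\sum_(v : F | v != 0) qchar (v - a)); last first.
  have : \sum_(v : F) qchar (v - a) = 0.
    by rewrite -[RHS]sum_qchar [RHS](reindex_inj (addIr (- a))).
  by rewrite (bigD1 0) //= sub0r addrC => /eqP; rewrite addr_eq0 => /eqP.
(* Since 0^-1 = 0, the map u -> y / u is a permutation of all of F fixing 0. *)
rewrite [RHS](reindex_inj (_ : injective (fun u => y / u))) /=; last first.
  by move=> u v /(mulfI y0)/invr_inj.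
apply: eq_big => [u|u u0]; first by rewrite mulf_eq0 (negPf y0) invr_eq0.
rewrite -qcharM -(qchar_sqrM u (y / u - a)) //; congr qchar.
by field.
Qed.

(** With weights 1 + eta(u), the sum of eta(y - a u) vanishes and the Jacobi sum remains. The factor
    eta(-1) q is isolated to serve as [D] below. *)
Lemma sum_qchar_sub_sqr a y : a != 0 ->
  \sum_x (qchar (y - a * x ^+ 2))%:~R
    = (qchar a)%:~R * (((qchar (-1 : F))%:~R * #|F|%:R) * ((y == 0)%:R - #|F|%:R^-1)) :> rat.
Proof.
move=> a0; have F0 : (#|F|%:R : rat) != 0 by rewrite pnatr_eq0 -lt0n; apply/card_gt0P; exists 0.
rewrite (sum_sqr (fun u => (qchar (y - a * u))%:~R)).
have -> : \sum_u (qchar (y - a * u))%:~R * (1 + qchar u)%:~R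
    = (\sum_u qchar (y - a * u) + \sum_u qchar (y - a * u) * qchar u)%:~R :> rat.
  by rewrite -big_split rmorph_sum; apply: eq_bigr => u _; rewrite /= -rmorphM mulrDr mulr1.
have -> : \sum_(u : F) qchar (y - a * u) = 0.
  rewrite -[RHS]sum_qchar [RHS](reindex_inj (_ : injective (fun u => y - a * u))) //.
  by move=> u v /addrI/oppr_inj/(mulfI a0).
rewrite add0r sum_qchar_jacobi // -[- a]mulN1r qcharM !rmorphM rmorphB rmorphM /= !pmulrn.
by move: F0; rewrite pmulrn; case: (y == 0) => F0; field.
Qed.

End QuadraticCharacter.

(** * Counting solutions one variable at a time *)

Definition ffun_cons {T : Type} {n} (x : T) (g : {ffun 'I_n -> T}) : {ffun 'I_n.+1 -> T} :=
  [ffun i => oapp g x (unlift ord0 i)].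

Lemma big_ffun_recl {R : nmodType} {T : finType} {n} (P : pred {ffun 'I_n.+1 -> T})
    (f : {ffun 'I_n.+1 -> T} -> R) :
  \sum_(g | P g) f g = \sum_x \sum_(g | P (ffun_cons x g)) f (ffun_cons x g).
Proof.
rewrite pair_big_dep /=.
apply: (reindex (fun p : T * {ffun 'I_n -> T} => ffun_cons p.1 p.2)).
apply: onW_bij.
exists (fun g : {ffun 'I_n.+1 -> T} => (g ord0, [ffun i => g (lift ord0 i)])) => [[x g]|g] /=.
  by rewrite ffunE unlift_none; congr pair; apply/ffunP => i; rewrite !ffunE liftK.
by apply/ffunP => i; rewrite ffunE; case: unliftP => [j ->|->] //=; rewrite ffunE.
Qed.

Section DiagonalCount.
Context (F : finFieldType) (h : F -> rat) (D : rat).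
Let q : rat := #|F|%:R.

(* The linear map sending 'X^r to the function h_r given by
   h_(2j) y = D^j * ([y = 0] - 1/q) and h_(2j+1) y = D^j * h y. *)
Definition poly_fun (y : F) (p : {poly rat}) : rat :=
  (even_poly p).[D] * ((y == 0)%:R - q^-1) + (odd_poly p).[D] * h y.

(** Summing over a variable exchanges the two basis functions, with a factor D on the way from h
    back to the indicator; this is multiplication by ['X] split into parities. *)
Lemma sum_poly_fun (v : F -> F) (w : rat) y p :
  (forall y, \sum_x ((y == v x)%:R - q^-1) = w * h y) ->
  (forall y, \sum_x h (y - v x) = w * (D * ((y == 0)%:R - q^-1))) ->
  \sum_x poly_fun (y - v x) p = w * poly_fun y (p * 'X).
Proof.
move=> vE hE; rewrite big_split /= -!mulr_sumr hE.
under eq_bigr do rewrite subr_eq0.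
by rewrite vE /poly_fun even_polyMX odd_polyMX hornerMX; ring.
Qed.

Lemma poly_fun_step y p (w c : rat) :
  poly_fun y ((w *: 'X - c%:P) * p) = w * poly_fun y (p * 'X) - c * poly_fun y p.
Proof.
rewrite mulrBl -scalerAl mul_polyC [_ * p]mulrC /poly_fun !raddfB /= !linearZ /=.
by rewrite !(hornerD, hornerN, hornerZ, hornerMX); ring.
Qed.

(** The flag [z] allows zero coordinates. When it is false, removing x = 0 from each sum subtracts
    the count in the remaining variables at the same y, turning q into q - 1 and w X into w X -
    1. *)
Lemma count_diagonal n (v : 'I_n -> F -> F) (w : 'I_n -> rat) (z : bool) y :
  (forall i, v i 0 = 0) ->
  (forall i y, \sum_x ((y == v i x)%:R - q^-1) = w i * h y) ->
  (forall i y, \sum_x h (y - v i x) = w i * (D * ((y == 0)%:R - q^-1))) ->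
  \sum_(x : {ffun 'I_n -> F} | [forall i, z || (x i != 0)])
     (y == \sum_i v i (x i))%:R =
  (q - (~~ z)%:R) ^+ n / q + poly_fun y (\prod_i (w i *: 'X - (~~ z)%:R%:P)).
Proof.
elim: n v w y => [|n IH] v w y v0 vE hE.
  have all0 (x : {ffun 'I_0 -> F}) : [forall i, z || (x i != 0)] = true.
    by apply/forallP => - [].
  rewrite (eq_bigl _ _ all0).
  under eq_bigr do rewrite big_ord0.
  rewrite sumr_const card_ffun card_ord expn0 mulr1n big_ord0.
  rewrite /poly_fun -polyC1 even_polyC odd_polyC hornerC horner0 expr0.
  ring.
rewrite big_ffun_recl /=.
set p := \prod_(i < n) (w (lift ord0 i) *: 'X - (~~ z)%:R%:P).
pose G x := (q - (~~ z)%:R) ^+ n / q + poly_fun (y - v ord0 x) p.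
transitivity (\sum_(x | z || (x != 0)) G x).
  rewrite [RHS]big_mkcond; apply: eq_bigr => x _.
  have consP (g : {ffun 'I_n -> F}) :
      [forall i, z || (ffun_cons x g i != 0)] =
      (z || (x != 0)) && [forall i, z || (g i != 0)].
    apply/forallP/andP => [H|[x0 /forallP H] i].
      split; first by have := H ord0; rewrite ffunE unlift_none.
      by apply/forallP => i; have := H (lift ord0 i); rewrite ffunE liftK.
    by rewrite ffunE; case: unliftP => [j _|_] //=.
  rewrite (eq_bigl _ _ consP); case: ifP => _; last by rewrite big_pred0.
  rewrite /G -(IH (fun i => v (lift ord0 i)) (fun i => w (lift ord0 i))) //=.
  apply: eq_bigr => g _; rewrite big_ord_recl ffunE unlift_none /=.
  under eq_bigr do rewrite ffunE liftK /=.
  by rewrite subr_eq addrC.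
have -> : \sum_(x | z || (x != 0)) G x = \sum_x G x - (~~ z)%:R * G 0.
  case: (z) => /=; first by rewrite mul0r subr0; apply: eq_bigl.
  by rewrite [\sum_x G x](bigD1 0) //= mul1r addrAC subrr add0r.
rewrite /G v0 subr0 big_split /= sumr_const -[_ *+ #|_|]mulr_natl.
rewrite (sum_poly_fun _ (w ord0)) // big_ord_recl poly_fun_step exprS.
by rewrite -/q -/p; ring.
Qed.

End DiagonalCount.

(** * From product polynomials to elementary symmetric functions *)

(** Expand over the set J of factors from which the term in ['X] is chosen; J contributes in degree
    #|J|. *)
Lemma coef_prod_linear (c : rat) (s : seq int) (r : nat) :
  (\prod_(x <- s) (x%:~R *: 'X + c%:P))`_r = c ^+ (size s - r) * (esym_seq s r)%:~R.
Proof.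
rewrite (big_nth 0) big_mkord bigA_distr /= coef_sum.
rewrite /esym_seq rmorph_sum mulr_sumr [RHS]big_mkcond /=.
apply: eq_bigr => J _. 
have -> : \prod_(i < size s) (if i \in J then (s`_i)%:~R *: 'X else c%:P)
  = (c ^+ (size s - #|J|) * (\prod_(i in J) s`_i)%:~R) *: 'X^#|J|.
  rewrite (bigID (mem J)) /=.
  rewrite (eq_bigr (fun i : 'I__ => (s`_i)%:~R *: 'X)) => [|i ->//].
  rewrite [X in _ * X](eq_bigr (fun=> c%:P)) => [|i /negPf->//].
  rewrite scaler_prod !prodr_const rmorph_prod /=.
  have -> : (size s - #|J|)%N = #|[predC J]| by rewrite -[X in (X - _)%N]card_ord -(cardC J) addKn.
  rewrite -polyC_exp mulrC mul_polyC scalerA; congr (_ ^+ _ * _ *: _).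
rewrite coefZ coefXn; case: eqVneq => [->|_]; first by rewrite mulr1.
by rewrite mulr0.
Qed.

(** All zeros minus those without zero coordinate; the two predicates are written as the cases of
    the flag [z] in [count_diagonal]. *)
Lemma card_zeros_with_zero {F : finFieldType} {n} (a : 'I_n -> F) (c : 'I_n -> nat) :
  let count (P : pred {ffun 'I_n -> F}) : rat :=
    \sum_(x | P x) (0 == \sum_i a i * x i ^+ c i)%:R in
  #|zeros_with_zero a c|%:R =
  count (fun x => [forall i, true || (x i != 0)]) -
  count (fun x => [forall i, false || (x i != 0)]).
Proof.
rewrite /= -sum1_card natr_sum big_mkcond /= [X in _ = X - _]big_mkcond /=.
rewrite [X in _ = _ - X]big_mkcond -sumrB; apply: eq_bigr => x _.
rewrite inE eq_sym.
have -> : [forall i : 'I_n, true] by apply/forallP.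
have -> : [exists i, x i == 0] = ~~ [forall i, x i != 0].
  by rewrite negb_forall; apply: eq_existsb => i; rewrite negbK.
by case: (0 == _) => /=; case: [forall i, _] => /=; rewrite ?subrr ?subr0.
Qed.

Lemma card_ord_ge n t : (t <= n)%N -> #|[pred i : 'I_n | (t <= i)%N]| = (n - t)%N.
Proof.
move=> tn; rewrite -[X in (X - _)%N]card_ord -(cardC [pred i : 'I_n | (t <= i)%N]).
rewrite -[X in (_ + X)%N]sum1_card.
rewrite (eq_bigl (fun i : 'I_n => (i < t)%N)) => [|i]; last by rewrite !inE -ltnNge.
by rewrite -(big_ord_widen n (fun=> 1%N)) // sum1_card card_ord addnK.
Qed.

(** The list eta(a_{t+1}), ..., eta(a_n), with indices counted from 0. *)
Definition qchars_from {F : finFieldType} {n} (a : 'I_n -> F) (t : nat) : seq int :=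
  map (fun i : 'I_n => qchar (a i)) (filter (fun i : 'I_n => (t <= i)%N) (enum 'I_n)).

Lemma size_qchars_from {F : finFieldType} {n} (a : 'I_n -> F) t :
  (t <= n)%N -> size (qchars_from a t) = (n - t)%N.
Proof.
by move=> tn; rewrite size_map size_filter -sum1_count big_enum_cond sum1_card card_ord_ge.
Qed.

(** A linear variable takes each value once, so its weight is 0 and its factor is the constant -c,
    with c = 1 if zero coordinates are excluded and c = 0 otherwise. At y = 0 only the even part of
    the product survives, evaluated at D = eta(-1) q. *)
Lemma count_linear_quadratic {F : finFieldType} {n} (a : 'I_n -> F) (t : nat) (z : bool) :
  let q : rat := #|F|%:R in
  (forall i, a i != 0) -> (t <= n)%N -> ((t < n)%N -> (2 : F) != 0) ->
  \sum_(x : {ffun 'I_n -> F} | [forall i, z || (x i != 0)])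
     (0 == \sum_i a i * x i ^+ (if i < t then 1 else 2)%N)%:R =
  (q - (~~ z)%:R) ^+ n / q + (q - 1) / q *
    \sum_(j < ((n - t) %/ 2).+1) (- (~~ z)%:R) ^+ (n - 2 * j) *
       ((qchar ((-1 : F) ^+ j))%:~R * (esym_seq (qchars_from a t) (2 * j))%:~R * q ^+ j).
Proof.
move=> q a0 tn char_odd.
have q0 : q != 0 by rewrite pnatr_eq0 -lt0n; apply/card_gt0P; exists 0.
(* Setting h to 0 for t = n covers characteristic 2, where all variables are linear. *)
pose h (y : F) : rat := if (t < n)%N then (qchar y)%:~R else 0.
pose w (i : 'I_n) : rat := if (i < t)%N then 0 else (qchar (a i))%:~R.
pose D : rat := (qchar (-1 : F))%:~R * q.
have sum_h : \sum_y h y = 0.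
  rewrite /h; case: (boolP (t < n)%N) => [/char_odd c2|_]; last by rewrite big1.
  by rewrite -[RHS](mulr0z 1) -(sum_qchar F c2) [RHS]rmorph_sum.
have tn_of (i : 'I_n) : ~~ (i < t)%N -> (t < n)%N.
  by rewrite -leqNgt => /leq_ltn_trans; apply.
rewrite (count_diagonal F h D n (fun i x => a i * x ^+ (if i < t then 1 else 2)%N) w).
- congr (_ + _); rewrite /poly_fun eqxx.
  have -> : h 0 = 0 by rewrite /h qchar0; case: ifP.
  set p := \prod_i _; rewrite mulr0 addr0 mulrC.
  rewrite (_ : true%:R - _ = (q - 1) / q); last by rewrite mulrBl mulfV // mul1r.
  congr (_ * _); set c : rat := (~~ z)%:R.
  have pE : p = (- c) ^+ t *: \prod_(x <- qchars_from a t) (x%:~R *: 'X + (- c)%:P).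
    rewrite /p (bigID (fun i : 'I_n => (i < t)%N)) /= big_map big_filter big_enum_cond /=.
    rewrite -mul_polyC; congr (_ * _); last first.
      apply: eq_big => [i|i]; first by rewrite -leqNgt.
      by rewrite /w polyCN => /negPf->.
    rewrite (eq_bigr (fun=> (- c)%:P)) => [|i it]; last by rewrite /w it scale0r sub0r polyCN.
    by rewrite -(big_ord_widen n (fun=> (- c)%:P)) // prodr_const card_ord polyC_exp.
  have coefp r : p`_r = (- c) ^+ (t + (n - t - r)) * (esym_seq (qchars_from a t) r)%:~R.
    by rewrite pE coefZ coef_prod_linear size_qchars_from // exprD mulrA.
  have szp : (size p <= (n - t).+1)%N.
    rewrite pE; apply: leq_trans (size_scale_leq _ _) _.
    rewrite -(size_qchars_from a t tn).
    elim: (qchars_from a t) => [|x s IH]; first by rewrite big_nil size_poly1.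
    rewrite big_cons; apply: leq_trans (size_polyMleq _ _) _.
    have : (size ((x%:~R *: 'X + (- c)%:P)%R : {poly rat}) <= 2)%N.
      apply: leq_trans (size_polyD _ _) _; rewrite geq_max.
      rewrite (leq_trans (size_scale_leq _ _)) ?size_polyX //.
      by rewrite (leq_trans (size_polyC_leq1 _)).
    by move=> sz2; rewrite -subn1 leq_subLR; apply: leq_trans (leq_add sz2 IH) _.
  rewrite (horner_coef_wide _ (_ : (size (even_poly p) <= ((n - t) %/ 2).+1)%N)); last first.
    by apply: leq_trans (size_even_poly _) _; move: szp; lia.
  apply: eq_bigr => j _; rewrite coef_even_poly coefp -mul2n -mulrA.
  have jn : (2 * j <= n - t)%N by have := ltn_ord j; lia.
  rewrite (_ : t + (n - t - 2 * j) = n - 2 * j)%N; last by lia.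
  have -> : qchar ((-1 : F) ^+ j) = qchar (-1 : F) ^+ j.
    have [/char_odd c2|] := ltnP t n; first by rewrite qcharX.
    case: (nat_of_ord j) jn => [_ _|k jn nt]; last by lia.
    by rewrite !expr0 qchar1.
  by rewrite /D exprMn rmorphXn /=; ring.
- by move=> i /=; case: ifP => _; rewrite ?expr0n mulr0.
- move=> i y /=; rewrite /w; case: ifPn => it.
    rewrite mul0r sumrB sumr_const -[_^-1 *+ _]mulr_natl mulfV //.
    rewrite (bigD1 (y / a i)) //= big1 => [|x]; first by rewrite expr1 mulrC divfK // eqxx addr0 subrr.
    by move=> ne; case: eqP => // yE; case/eqP: ne; rewrite yE expr1 mulrC mulKf.
  by rewrite sum_eq_scaled_sqr ?char_odd /h ?(tn_of i).
- move=> i y /=; rewrite /w; case: ifPn => it.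
    rewrite mul0r -[RHS]sum_h [RHS](reindex_inj (_ : injective (fun u => y - a i * u ^+ 1))) //.
    by move=> u v; rewrite !expr1 => /addrI/oppr_inj/(mulfI (a0 i)).
  rewrite /h (tn_of i) //.
  by rewrite sum_qchar_sub_sqr // char_odd // (tn_of i).
Qed.

(** * Odd characteristic and assembly of the formulas *)

(** Translation by 1 permutes F and adds q to the sum of its elements. *)
Lemma natr_card_finField (F : finFieldType) : #|F|%:R = 0 :> F.
Proof.
apply: (addrI (\sum_(x : F) x)); rewrite addr0.
rewrite [RHS](reindex_inj (addIr 1)) big_split /=.
by congr (_ + _); rewrite sumr_const.
Qed.

Lemma two_neq0_finField (F : finFieldType) : odd #|F| -> (2 : F) != 0.
Proof.
move=> oF; apply/eqP => F2; have := natr_card_finField F.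
rewrite -(odd_double_half #|F|) oF -mul2n natrD natrM F2 mul0r addr0.
by move/eqP; rewrite oner_eq0.
Qed.

Lemma esym_seq0 (s : seq int) : esym_seq s 0 = 1.
Proof.
by rewrite /esym_seq (big_pred1 set0) => [|J]; rewrite ?big_set0 ?cards_eq0.
Qed.

Lemma sum_esym_shift {F : finFieldType} (s : seq int) (K : nat) :
  let q : rat := #|F|%:R in
  \sum_(j < K.+1) (qchar ((-1 : F) ^+ j))%:~R * (esym_seq s (2 * j))%:~R * q ^+ j =
  1 + q * \sum_(1 <= j < K.+1)
            (qchar ((-1 : F) ^+ j))%:~R * (esym_seq s (2 * j))%:~R * q ^+ j.-1.
Proof.
move=> q; rewrite big_ord_recl muln0 esym_seq0 !expr0 qchar1 !mulr1.
rewrite big_add1 big_mkord mulr_sumr; congr (_ + _).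
by apply: eq_bigr => j _; rewrite lift0 (exprS q); ring.
Qed.

Lemma card_linear_quadratic_zeros {F : finFieldType} {n} (a : 'I_n -> F) (t : nat) :
  let q : rat := #|F|%:R in
  let S K := \sum_(1 <= j < K.+1)
     (qchar ((-1 : F) ^+ j))%:~R * (esym_seq (qchars_from a t) (2 * j))%:~R * q ^+ j.-1 in
  let N : rat := #|zeros_with_zero a (fun i => if i < t then 1 else 2)%N|%:R in
  (2 <= n)%N -> (forall i, a i != 0) -> (t <= n)%N -> ((t < n)%N -> (2 : F) != 0) ->
  (t = 0%N /\ ~~ odd n ->
    N = q ^+ n.-1 - ((q - 1) ^+ n + q - 1) / q - (q - 1) * S ((n - 2) %/ 2)%N) /\
  (~ (t = 0%N /\ ~~ odd n) ->
    N = q ^+ n.-1 - ((q - 1) ^+ n + (-1) ^+ n * (q - 1)) / q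
        - (-1) ^+ n * (q - 1) * S ((n - t) %/ 2)%N).
Proof.
move=> q S N n2 a0 tn char_odd.
have q0 : q != 0 by rewrite pnatr_eq0 -lt0n; apply/card_gt0P; exists 0.
have qn : q ^+ n = q * q ^+ n.-1 by rewrite -exprS prednK // ltnW.
rewrite /N card_zeros_with_zero !count_linear_quadratic //= -/q.
pose T (j : nat) : rat :=
  (qchar ((-1 : F) ^+ j))%:~R * (esym_seq (qchars_from a t) (2 * j))%:~R * q ^+ j.
have sumT K : \sum_(j < K.+1) T j = 1 + q * S K by exact: sum_esym_shift.
rewrite subr0 oppr0.
have -> : \sum_(j < ((n - t) %/ 2).+1) (- 1) ^+ (n - 2 * j) * T j
    = (-1) ^+ n * (1 + q * S ((n - t) %/ 2)%N) :> rat.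
  rewrite -sumT mulr_sumr; apply: eq_bigr => j _; congr (_ * _).
  have jn : (2 * j <= n)%N by have := ltn_ord j; lia.
  by rewrite -signr_odd oddB // oddM addbF signr_odd.
split=> [[t0 en]|nt].
  (* Only 2j = n gives a nonzero power of 0. This term will cancel the top term of the other count,
     so the sum stops at (n - 2)/2. *)
  have -> : \sum_(j < ((n - t) %/ 2).+1) 0 ^+ (n - 2 * j) * T j
      = (1 + q * S ((n - t) %/ 2)%N) - (1 + q * S ((n - 2) %/ 2)%N) :> rat.
    rewrite -!sumT (_ : (n - t) %/ 2 = ((n - 2) %/ 2).+1)%N; last by lia.
    rewrite big_ord_recr /= big1 => [|j _]; last first.
      by rewrite expr0n (_ : _ == _ = false) ?mul0r //; have := ltn_ord j; lia.
    rewrite (_ : n - _ = 0)%N; last by lia.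
    by rewrite add0r expr0 mul1r [X in X - _]big_ord_recr /= addrAC subrr add0r.
  rewrite -signr_odd (negPf en) expr0 qn.
  by field.
(* Here 2j = n is impossible: either n is odd, or t > 0 and 2j <= n - t < n. *)
have -> : \sum_(j < ((n - t) %/ 2).+1) 0 ^+ (n - 2 * j) * T j = 0 :> rat.
  rewrite big1 // => j _; rewrite expr0n (_ : _ == _ = false) ?mul0r //.
  by apply/negP => /eqP nj; apply: nt; have := ltn_ord j; lia.
by rewrite qn; field.
Qed.

Theorem theorem1 (F : finFieldType) (n : nat) (a : 'I_n -> F) (b : F)
    (k : nat) (kk m : 'I_n -> nat) (t : nat) :
  (2 <= n)%N ->
  (forall i, a i != 0) -> b != 0 ->
  (0 < k)%N -> (forall i, 0 < kk i)%N -> (forall i, 0 < m i)%N ->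
  let q := #|F| in
  let d := fun i : 'I_n => gcdn (m i) q.-1 in
  let k0 := gcdn k (gcdn (\big[gcdn/0%N]_(i < n) kk i) q.-1) in
  (t <= n)%N ->
  (forall i : 'I_n, (i < t)%N -> odd (d i)) ->
  (forall i : 'I_n, (t <= i)%N -> ~~ odd (d i)) ->
  (let d' := fun i : 'I_n => if (i < t)%N then d i else (d i)./2 in
   forall i j : 'I_n, i != j -> coprime (d' i) (d' j)) ->
  ~ (exists y : F, y ^+ k0 = b) ->
  let N := (Nsol a b k kk m)%:R : rat in
  let qq := q%:R : rat in
  let etas := map (fun i : 'I_n => qchar (a i)) (filter (fun i : 'I_n => (t <= i)%N) (enum 'I_n)) in
  (t = 0%N -> ~~ odd n ->
     N = qq ^+ n.-1 - ((qq - 1) ^+ n + qq - 1) / qq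
         - (qq - 1) * \sum_(1 <= j < ((n - 2) %/ 2).+1)
             (qchar ((-1 : F) ^+ j))%:~R * (esym_seq etas (2 * j))%:~R
               * qq ^+ j.-1) /\
  (t = n ->
     N = qq ^+ n.-1 - ((qq - 1) ^+ n + (-1) ^+ n * (qq - 1)) / qq) /\
  (~ (t = 0%N /\ ~~ odd n) -> t <> n ->
     N = qq ^+ n.-1 - ((qq - 1) ^+ n + (-1) ^+ n * (qq - 1)) / qq
         - (-1) ^+ n * (qq - 1) * \sum_(1 <= j < ((n - t) %/ 2).+1)
             (qchar ((-1 : F) ^+ j))%:~R * (esym_seq etas (2 * j))%:~R
               * qq ^+ j.-1).
Proof.
move=> n2 a0 b0 k_gt0 kk0 m0 q d k0 tn odd_d even_d cop nb N qq etas.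
have q1 : (0 < q.-1)%N by have := finField_gt1 F; rewrite /q; case: #|F| => [|[]].
have d_gt0 i : (0 < d i)%N by rewrite gcdn_gt0 q1 orbT.
have char_odd : (t < n)%N -> (2 : F) != 0.
  move=> lt_tn; apply: two_neq0_finField; rewrite -/q.
  (* An even d_i divides q - 1, so q is odd. *)
  have := even_d (Ordinal lt_tn) (leqnn t).
  rewrite -dvdn2 => /dvdn_trans/(_ (dvdn_gcdr _ _)).
  by move: q1; lia.
pose s (i : 'I_n) := (if i < t then 1 else 2)%N.
pose v (i : 'I_n) := (if i < t then d i else (d i)./2)%N.
have sv : d =1 (fun i => s i * v i)%N.
  move=> i; rewrite /s /v; case: ltnP => [_|/even_d]; first by rewrite mul1n.
  by rewrite mul2n => /even_halfK.
have NE : N = #|zeros_with_zero a s|%:R.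
  rewrite /N Nsol_zeros // card_zeros_gcd_pred // -/q.
  rewrite (eq_zeros_with_zero a _ _ sv) card_zeros_parity // => i.
    by have := d_gt0 i; rewrite sv muln_gt0 => /andP[].
  by rewrite /s /v; case: ltnP => [/odd_d|_]; [right|left].
have [even_case other_case] := card_linear_quadratic_zeros a t n2 a0 tn char_odd.
rewrite NE; split=> [t0 en|]; first exact: even_case.
split=> [tE|nt _]; last exact: other_case.
(* For t = n >= 2 the exceptional case t = 0 is excluded, and the sum over 1 <= j < 1 is empty. *)
rewrite other_case => [|[t0 _]]; last by move: n2; rewrite -tE t0.
by rewrite tE subnn big_geq // mulr0 subr0.
Qed.
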